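(* Let $K$ be a $3$-family on a finite vertex set $V(K)$. Then $$\lambda_1\left(\partial_2(K)\partial_2^*(K)\right)+\lambda_2\left(\partial_2(K)\partial_2^*(K)\right)\le d_1^\top(K)+d_2^\top(K),$$ where $\partial_2(K)\partial_2^*(K)$ denotes the up-Laplacian of $K$ and $\lambda_i$ denotes the $i$-th largest eigenvalue, counted with multiplicity.
   Context: A $3$-family $K$ on a finite vertex set $V(K)$ is a collection of distinct $3$-element subsets of $V(K)$ (not necessarily all triangles of some graph). Fix a linear order on $V(K)$. Let $C_2$ be the real inner product space with orthonormal basis the members of $K$, and let $C_1$ be the real inner product space with orthonormal basis the $2$-element subsets of $V(K)$ contained in some member of $K$. The boundary map $\partial_2(K):C_2\to C_1$ is the linear map with $\partial_2(\{i,j,k\})=\{j,k\}-\{i,k\}+\{i,j\}$ for $\{i,j,k\}\in K$ with $i<j<k$; $\partial_2^*(K)$ is its adjoint (transpose). The up-Laplacian is $\partial_2(K)\partial_2^*(K):C_1\to C_1$, which is symmetric and positive semidefinite; its spectrum does not depend on the linear order. If there are fewer than $i$ eigenvalues, $\lambda_i$ is taken to be $0$. For $v\in V(K)$, the degree $\deg_K(v)$ is the number of $3$-sets in $K$ that contain $v$. The conjugate degree sequence is $d_i^\top(K)=|\{v\in V(K):\deg_K(v)\ge i\}|$ for $i\ge1$. *)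

(* Defs.v *)
From mathcomp Require Import all_boot all_order all_algebra.
From mathcomp Require Import polyrcf.
From mathcomp Require Import reals.

Set Implicit Arguments.
Unset Strict Implicit.
Unset Printing Implicit Defensive.

Import Order.TTheory GRing.Theory Num.Theory.
Local Open Scope ring_scope.

(* All eigenvalues of A lying in R, in decreasing order, each repeated
   according to its multiplicity as a root of the characteristic polynomial;
   this is the whole spectrum when A is symmetric. *)
Definition spectrum (R : realType) (n : nat) (A : 'M[R]_n) : seq R :=
  let p := char_poly A in
  sort >=%R (flatten [seq nseq (mup x p) x | x <- rootsR p]).

(* Meant for i >= 1: eigval A 1 is the largest eigenvalue; the value is 0 as soon as
   i exceeds the number of eigenvalues. *)
Definition eigval (R : realType) (n : nat) (A : 'M[R]_n) (i : nat) : R :=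
  nth 0 (spectrum A) i.-1.

Definition is_3family (V : finType) (K : {set {set V}}) : Prop :=
  forall s : {set V}, s \in K -> #|s| = 3%N.

Definition edges (V : finType) (K : {set {set V}}) : {set {set V}} :=
  [set e : {set V} | (#|e| == 2%N) && [exists s in K, e \subset s]].

(* The coefficient of e in the boundary of s; s is listed increasingly, and the
   0 branch is never taken on a 3-element set. *)
Definition boundary_coef (R : realType) (d : Order.disp_t)
    (V : finOrderType d) (s e : {set V}) : R :=
  if sort <=%O (enum s) is [:: i; j; k] then
    (e == [set j; k])%:R - (e == [set i; k])%:R + (e == [set i; j])%:R
  else 0.

(* The matrix, acting on column vectors, of the boundary map with respect to
   the orthonormal bases K of C_2 and edges K of C_1; its adjoint is therefore
   its transpose. *)
Definition boundary2 (R : realType) (d : Order.disp_t) (V : finOrderType d)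
    (K : {set {set V}}) : 'M[R]_(#|edges K|, #|K|) :=
  \matrix_(a, b) boundary_coef R (enum_val b) (enum_val a).

Definition up_laplacian (R : realType) (d : Order.disp_t) (V : finOrderType d)
    (K : {set {set V}}) : 'M[R]_#|edges K| :=
  boundary2 R K *m (boundary2 R K)^T.

Definition deg (V : finType) (K : {set {set V}}) (v : V) : nat :=
  #|[set s in K | v \in s]|.

Definition conj_deg (V : finType) (K : {set {set V}}) (i : nat) : nat :=
  #|[set v : V | (i <= deg K v)%N]|.

Lemma boundary_coefE (R : realType) (d : Order.disp_t) (V : finOrderType d)
    (i j k : V) (e : {set V}) : (i < j)%O -> (j < k)%O ->
  boundary_coef R [set i; j; k] e =
    (e == [set j; k])%:R - (e == [set i; k])%:R + (e == [set i; j])%:R.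
Proof.
move=> ij jk; have ik := lt_trans ij jk.
rewrite /boundary_coef.
suff -> : sort <=%O (enum [set i; j; k]) = [:: i; j; k] by [].
apply: (sorted_eq (@le_trans _ V) (@le_anti _ V)).
- exact/sort_sorted/le_total.
- by rewrite /= (ltW ij) (ltW jk).
rewrite perm_sort; apply: uniq_perm; first exact: enum_uniq.
- by rewrite /= !inE negb_or (lt_eqF ij) (lt_eqF ik) (lt_eqF jk).
by move=> x; rewrite mem_enum !inE orbA.
Qed.

Lemma spectrumE (R : realType) (n : nat) (A : 'M[R]_n) (s : seq R) :
  char_poly A = \prod_(x <- s) ('X - x%:P) -> spectrum A = sort >=%R s.
Proof.
move=> As; apply/perm_sortP.
- by move=> x y; rewrite orbC le_total.
- by move=> y x z /= yx zy; apply: le_trans zy yx.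
- by move=> x y /= /andP[yx xy]; apply/le_anti/andP.
set p := char_poly A; have p0 : p != 0 by exact/monic_neq0/char_poly_monic.
have rE x : (x \in rootsR p) = (x \in s).
  have /(_ x) := roots_on_rootsR p0; rewrite in_itv /= => <-.
  by rewrite /p As root_prod_XsubC.
apply/allP => x _ /=; rewrite count_flatten -map_comp.
rewrite (eq_map (g := fun y => ((y == x) * count_mem x s)%N)); last first.
  move=> y /=; rewrite count_nseq /= /p As mu_prod_XsubC.
  by case: eqP => [->|].
rewrite sumnE big_map.
have ur : uniq (rootsR p) by exact: uniq_roots.
have [xr|xr] := boolP (x \in rootsR p).
  rewrite (bigD1_seq x) //= eqxx mul1n big1 ?addn0 //.
  by move=> y /negPf ->.
rewrite big1_seq; last first.
  by move=> y /= yr; case: eqP yr xr => // -> ->.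
by apply/eqP/esym/count_memPn; rewrite -rE.
Qed.

(* Main.v *)
Require Import Defs.
From mathcomp Require Import all_boot all_order all_algebra.
From mathcomp Require Import polyrcf.
From mathcomp Require Import reals.
From mathcomp Require Import ring lra.

Set Implicit Arguments.
Unset Strict Implicit.
Unset Printing Implicit Defensive.

Import Order.TTheory GRing.Theory Num.Theory.
Local Open Scope ring_scope.

(** Work with the triangle form u |-> |bd u|^2, which has the same nonzero
    spectrum. On a vertex set W of size m, summing squared curls over all
    ordered triples shows that the boundary of the complete 3-family satisfies
    |bd^T x|^2 = m |x|^2 - |div x|^2; hence lambda_1 <= n := d_1^T. Let the core
    be the set of the m := d_2^T vertices of degree at least 2. If lambda_2 <= m
    there is nothing more to do, and m <= 1 is degenerate (all triangles are
    edge-disjoint).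

    Otherwise, for mu > m, eliminate the coordinates of the triangles inside the
    core. On the coordinates g of the other triangles (at most n - m of them,
    each owning a vertex of degree 1), |bd u|^2 >= mu |u|^2 implies
    g^T H(mu) g >= (mu - m) |g|^2, where H(mu) is positive semidefinite with unit
    diagonal and affine in 1 / (mu - 2). Comparing its off-diagonal part with the
    block-diagonal part coming from triangles on a common edge shows that the
    largest eigenvalue of H(mu) is nonincreasing in mu. So H(lambda_2) has a
    vector with Rayleigh quotient at least lambda_1 - m, and, orthogonal to it, a
    vector of the plane spanned by the two eigenvectors, with quotient at least
    lambda_2 - m; the trace of H(lambda_2) then bounds their sum by n - m. *)

(** * Eigenvectors of a symmetric matrix for its two largest eigenvalues *)

Lemma rowvec_normE (R : realType) n (v : 'rV[R]_n) :
  (v *m v^T) 0 0 = \sum_i v 0 i ^+ 2.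
Proof. by rewrite mxE; apply: eq_bigr => i _; rewrite mxE expr2. Qed.

Lemma rowvec_norm_eq0 (R : realType) n (v : 'rV[R]_n) :
  ((v *m v^T) 0 0 == 0) = (v == 0).
Proof.
apply/eqP/eqP => [|->]; last by rewrite mul0mx mxE.
rewrite rowvec_normE => /psumr_eq0P h; apply/rowP => i; rewrite mxE.
by apply/eqP; rewrite -sqrf_eq0; apply/eqP/h => // j _; rewrite sqr_ge0.
Qed.

(** By symmetry, [u A A u^T] is the squared norm of [u A]. *)
Lemma sym_mulmx_sqr0 (R : realType) n (A : 'M[R]_n) (u : 'rV[R]_n) :
  A^T = A -> u *m A *m A = 0 -> u *m A = 0.
Proof.
move=> As uAA; apply/eqP; rewrite -rowvec_norm_eq0 trmx_mul As mulmxA uAA.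
by rewrite mul0mx mxE.
Qed.

(** Complete an eigenvector [v] to a basis: [A] becomes block triangular, and [a] is still a root of
    the characteristic polynomial of the remaining block [B']. An eigenvector of [B'] lifts to [w]
    with [w (A - a)] on the line of [v], so [w (A - a)^2 = 0], and symmetry gives
    [w (A - a) = 0]. *)
Lemma sym_double_eigenvalue (R : realType) n (A : 'M[R]_n) (a : R) :
  A^T = A -> ('X - a%:P) ^+ 2 %| char_poly A ->
  exists v w : 'rV[R]_n, [/\ v != 0, w != 0, v *m A = a *: v,
    w *m A = a *: w & v *m w^T = 0].
Proof.
case: n A => [|n] A As dvd.
  move: (dvdp_leq (monic_neq0 (char_poly_monic A)) dvd).
  by rewrite size_char_poly size_exp_XsubC.
have ra : root (char_poly A) a.
  rewrite root_factor_theorem; apply: dvdp_trans dvd; rewrite expr2.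
  exact: dvdp_mulr.
have /eigenvalueP [v vA v0] : eigenvalue A a by rewrite eigenvalue_root_char.
pose Q : 'M[R]_(1 + n) := row_ebase v.
have Qu : Q \in unitmx by exact: row_ebase_unit.
(* As [v] has rank 1, the first row of [row_ebase v] spans its line. *)
have [c [c0 vE]] : exists c, c != 0 /\ v = c *: row 0 Q.
  exists (col_ebase v 0 0); have := col_ebase_unit v.
  rewrite unitmxE det_mx11 unitfE => c0; split => //.
  rewrite -[LHS]mulmx_ebase rank_rV v0; apply/rowP => j; rewrite !mxE /=.
  under eq_bigr => k _ do rewrite mxE big_ord1 !mxE /=.
  by rewrite big_ord_recl /= mulr1 big1 ?addr0 // => k _; rewrite mulr0 mul0r.
have [B BD] : exists B : 'M[R]_(1 + n), B = Q *m A *m invmx Q by eexists.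
have QA : Q *m A = B *m Q by rewrite BD mulmxKV.
have rB : row 0 B = a *: row 0 1%:M.
  have q0A : row 0 Q *m A = a *: row 0 Q.
    by apply: (scalerI c0); rewrite scalemxAl -vE vA scalerA mulrC -scalerA -vE.
  rewrite BD row_mul row_mul q0A -scalemxAl -row_mul mulmxV //.
pose B' := drsubmx B.
have BE : B = block_mx a%:M 0 (dlsubmx B) B'.
  rewrite -[LHS]submxK; congr (block_mx _ _ _ _).
    apply/matrixP => i j; rewrite !ord1.
    transitivity (row 0 B 0 (lshift n 0)); last by rewrite rB !mxE /= mulr1n mulr1.
    by rewrite !mxE; congr (B _ _); apply/val_inj.
  apply/matrixP => i j; rewrite !ord1.
  transitivity (row 0 B 0 (rshift 1 j)); last by rewrite rB !mxE /= mulr0.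
  by rewrite !mxE; congr (B _ _); apply/val_inj.
have cpA : char_poly A = ('X - a%:P) * char_poly B'.
  have -> : char_poly A = char_poly B.
    rewrite /char_poly /char_poly_mx.
    set q := map_mx polyC Q.
    have qu : q \in unitmx by rewrite map_unitmx.
    have -> : map_mx polyC B = q *m map_mx polyC A *m invmx q.
      by rewrite BD !map_mxM /= map_invmx.
    have -> : 'X%:M - q *m map_mx polyC A *m invmx q =
              q *m ('X%:M - map_mx polyC A) *m invmx q.
      by rewrite mulmxBr mulmxBl scalar_mxC mulmxK.
    rewrite !det_mulmx mulrAC -det_mulmx mulmxV // det1 mul1r //.
  rewrite {1}BE /char_poly /char_poly_mx map_block_mx /= map_mx0.
  rewrite scalar_mx_block opp_block_mx add_block_mx subr0 det_lblock.
  by rewrite map_scalar_mx -raddfB /= det_scalar1.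
have : root (char_poly B') a.
  rewrite root_factor_theorem.
  by move: dvd; rewrite cpA expr2 dvdp_mul2l ?polyXsubC_eq0.
rewrite -eigenvalue_root_char => /eigenvalueP [u uB u0].
pose w : 'rV[R]_n.+1 := row_mx (0 : 'M_1) u *m Q.
pose N := A - a%:M.
have Ns : N^T = N by rewrite /N linearB /= tr_scalar_mx As.
have vN : v *m N = 0 by rewrite mulmxBr vA mul_mx_scalar subrr.
have q0N : row 0 Q *m N = 0.
  by apply: (scalerI c0); rewrite scaler0 scalemxAl -vE.
have wN : exists t, w *m N = t *: row 0 Q.
  exists ((u *m dlsubmx B) 0 0).
  rewrite /w mulmxBr -!mulmxA QA mul_mx_scalar !mulmxA {1}BE mul_row_block.
  rewrite !mul0mx !add0r uB -scalemxAr scalemxAl -mulmxBl.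
  rewrite scale_row_mx scaler0 opp_row_mx.
  rewrite add_row_mx subr0 subrr.
  set t := (u *m dlsubmx B) 0 0.
  have -> : u *m dlsubmx B = t *: 1%:M by rewrite scalemx1 -mx11_scalar.
  rewrite -[in LHS](scaler0 _ t) -scale_row_mx -scalemxAl.
  congr (_ *: _); rewrite rowE; congr (_ *m _).
  apply/rowP => j; rewrite !mxE; case: splitP => k jk; rewrite !mxE.
    by rewrite (ord1 k) -[j == 0]val_eqE /= jk (ord1 k).
  by rewrite -[j == 0]val_eqE /= jk.
have {}wN : w *m N = 0.
  case: wN => t tE; apply: sym_mulmx_sqr0 => //.
  by rewrite tE -scalemxAl q0N scaler0.
(* Gram-Schmidt: the projection of [w] on [v] is subtracted. *)
pose k := (w *m v^T) 0 0 / (v *m v^T) 0 0.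
exists v, (w - k *: v); split => //.
- apply: contra_neq u0 => /eqP; rewrite subr_eq0 vE => /eqP wv.
  have : w *m invmx Q = (k *: (c *: row 0 Q)) *m invmx Q by rewrite -wv.
  rewrite /w mulmxK // scalerA -scalemxAl -row_mul mulmxV // => /rowP E.
  apply/rowP => j; have := E (rshift 1 j).
  rewrite row_mxEr !mxE => ->.
  by rewrite -val_eqE /= mulr0.
- have : (w - k *: v) *m N = 0 by rewrite mulmxBl wN -scalemxAl vN scaler0 subrr.
  by rewrite mulmxBr mul_mx_scalar => /eqP; rewrite subr_eq0 => /eqP.
- rewrite linearB /= linearZ /= mulmxBr -scalemxAr.
  have -> : v *m w^T = (w *m v^T)^T by rewrite [RHS]trmx_mul trmxK.
  rewrite [w *m _]mx11_scalar [v *m _]mx11_scalar tr_scalar_mx scale_scalar_mx.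
  by rewrite divfK ?rowvec_norm_eq0 // subrr.
Qed.

Lemma count_spectrum (R : realType) n (A : 'M[R]_n) (x : R) :
  count_mem x (spectrum A) = mup x (char_poly A).
Proof.
set p := char_poly A; have p0 : p != 0 by exact/monic_neq0/char_poly_monic.
rewrite /spectrum (permP (permEl (perm_sort _ _))) count_flatten -map_comp.
rewrite (eq_map (g := fun y => ((y == x) * mup x p)%N)); last first.
  by move=> y /=; rewrite count_nseq /=; case: eqP => [->|].
rewrite sumnE big_map.
have rE : (x \in rootsR p) = root p x.
  by have /(_ x) := roots_on_rootsR p0; rewrite in_itv /=.
have ur : uniq (rootsR p) by exact: uniq_roots.
have [xr|xr] := boolP (x \in rootsR p).
  by rewrite (bigD1_seq x) //= eqxx mul1n big1 ?addn0 // => y /negPf ->.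
rewrite big1_seq.
  by apply/esym/eqP; rewrite -leqn0 mup_leq // expr1 -root_factor_theorem -rE.
by move=> y /= yr; case: eqP yr xr => // -> ->.
Qed.

Lemma spectrum_eigenvector (R : realType) n (A : 'M[R]_n) (x : R) :
  x \in spectrum A -> exists2 v : 'rV[R]_n, v *m A = x *: v & v != 0.
Proof.
move=> xA; apply/eigenvalueP.
rewrite eigenvalue_root_char root_factor_theorem -['X - _]expr1.
rewrite -mup_geq ?monic_neq0 ?char_poly_monic //.
by rewrite -count_spectrum -has_count has_pred1.
Qed.

Lemma eigval1_eigenvector (R : realType) n (A : 'M[R]_n) :
  eigval A 1 != 0 -> exists2 v : 'rV[R]_n, v *m A = eigval A 1 *: v & v != 0.
Proof.
rewrite /eigval /=; case: (ltnP 0 (size (spectrum A))) => s0.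
  by move=> _; apply/spectrum_eigenvector/mem_nth.
by rewrite nth_default ?eqxx.
Qed.

(** Since [nth] defaults to 0, a nonzero second value means that the spectrum has two entries.
    Distinct values have orthogonal eigenvectors by symmetry; equal ones form a double root. *)
Lemma eigval12_eigenvectors (R : realType) n (A : 'M[R]_n) :
  A^T = A -> eigval A 2 != 0 ->
  eigval A 2 <= eigval A 1 /\
  exists v w : 'rV[R]_n, [/\ v != 0, w != 0, v *m A = eigval A 1 *: v,
    w *m A = eigval A 2 *: w & v *m w^T = 0].
Proof.
move=> As; rewrite /eigval /=.
have ss : sorted >=%R (spectrum A).
  by apply: sort_sorted => x y; rewrite orbC le_total.
have := @spectrum_eigenvector R n A; have := @count_spectrum R n A.
move: ss; case: (spectrum A) => [|a [|b s]] /=; try by rewrite eqxx.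
move=> /andP[ba _] cnt eig _; split => //.
have [abE|ab] := eqVneq a b.
  rewrite -abE; apply: sym_double_eigenvalue => //.
  rewrite -mup_geq ?monic_neq0 ?char_poly_monic //.
  by rewrite -cnt /= abE eqxx.
have [v vA v0] := eig a (mem_head _ _).
have [w wA w0] : exists2 w : 'rV_n, w *m A = b *: w & w != 0.
  by apply: eig; rewrite !inE eqxx orbT.
exists v, w; split => //; apply/eqP.
have : (a - b) *: (v *m w^T) = 0.
  rewrite scalerBl scalemxAl -vA scalemxAr -linearZ /= -wA trmx_mul As.
  by rewrite mulmxA subrr.
by move=> /eqP; rewrite scaler_eq0 subr_eq0 (negPf ab).
Qed.

(** With at most one nonzero term there are no cross terms. This serves pairs of vertices not both
    in the core, which lie in at most one triangle. *)
Lemma sqr_sum_single (R : pzSemiRingType) (I : finType) (P : {set I}) (h : I -> R) :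
  {in P &, forall i j, h i != 0 -> h j != 0 -> i = j} ->
  (\sum_(i in P) h i) ^+ 2 = \sum_(i in P) h i ^+ 2.
Proof.
move=> uh.
have [/existsP[i /andP[iP hi]]|] := boolP [exists i, (i \in P) && (h i != 0)].
  have h0 j : j \in P -> j != i -> h j = 0.
    by move=> jP; apply: contra_neq_eq => hj; exact: uh.
  rewrite !(bigD1 i iP) /= !big1 ?addr0 // => j /andP[jP ji].
    by rewrite h0 ?expr0n.
  exact: h0.
rewrite negb_exists => /forallP h0.
have {}h0 j : j \in P -> h j = 0.
  by move=> jP; have := h0 j; rewrite jP negbK => /eqP.
by rewrite !big1 ?expr0n // => j /h0 ->; rewrite ?expr0n.
Qed.


(** * Traces against Rayleigh quotients at two orthogonal vectors *)

Section TwoVectorTrace.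

Variables (R : realFieldType) (I : finType) (T : {set I}).
Implicit Types (f g y w : I -> R) (Q : (I -> R) -> R).

Definition sqnorm f : R := \sum_(s in T) f s ^+ 2.

Lemma sqnorm_ge0 f : 0 <= sqnorm f.
Proof. by apply: sumr_ge0 => s _; exact: sqr_ge0. Qed.

(* [Q] is meant to be a nonnegative quadratic form, whose trace is then at
   least the sum of its Rayleigh quotients at two orthogonal vectors. *)
Definition trace_dominates Q : Prop := forall y w,
  0 < sqnorm y -> 0 < sqnorm w -> \sum_(s in T) y s * w s = 0 ->
  Q y / sqnorm y + Q w / sqnorm w <= \sum_(s in T) Q (fun t => (t == s)%:R).

(** The square of the linear form [f] has trace [sqnorm f], so this is Bessel's inequality for [f]
    against [y] and [w]. *)
Lemma trace_dominates_sqr f Q :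
  (forall g, Q g = (\sum_(s in T) f s * g s) ^+ 2) -> trace_dominates Q.
Proof.
move=> QE y w y0 w0 yw; rewrite !QE (eq_bigr _ (fun _ _ => QE _)).
set a := \sum_(s in T) f s * y s; set b := \sum_(s in T) f s * w s.
have -> : \sum_(s in T) (\sum_(t in T) f t * (t == s)%:R) ^+ 2 = sqnorm f.
  apply: eq_bigr => s sT; congr (_ ^+ 2); rewrite (bigD1 s) //= eqxx mulr1.
  by rewrite big1 ?addr0 // => t /andP[_ /negPf ->]; rewrite mulr0.
have expand p q : \sum_(s in T) (f s - p * y s - q * w s) ^+ 2 =
   sqnorm f + p ^+ 2 * sqnorm y + q ^+ 2 * sqnorm w - 2 * p * a - 2 * q * b
   + 2 * p * q * \sum_(s in T) y s * w s.
  rewrite /a /b /sqnorm !mulr_sumr -!sumrN -!big_split /=.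
  by apply: eq_bigr => s _; ring.
have : 0 <= \sum_(s in T) (f s - a / sqnorm y * y s - b / sqnorm w * w s) ^+ 2.
  by apply: sumr_ge0 => s _; exact: sqr_ge0.
rewrite expand yw mulr0 addr0 => h; rewrite -subr_ge0.
suff <- : sqnorm f + (a / sqnorm y) ^+ 2 * sqnorm y
    + (b / sqnorm w) ^+ 2 * sqnorm w - 2 * (a / sqnorm y) * a
    - 2 * (b / sqnorm w) * b
  = sqnorm f - (a ^+ 2 / sqnorm y + b ^+ 2 / sqnorm w) by [].
by field; rewrite !gt_eqF.
Qed.

Lemma trace_dominates_sum (J : Type) (r : seq J) (P : pred J)
    (q : J -> (I -> R) -> R) :
  (forall j, P j -> trace_dominates (q j)) ->
  trace_dominates (fun g => \sum_(j <- r | P j) q j g).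
Proof.
move=> qP y w y0 w0 yw; rewrite exchange_big /= !mulr_suml -big_split /=.
by apply: ler_sum => j Pj; exact: qP.
Qed.

Lemma trace_dominates_scale Q (k : R) :
  0 <= k -> trace_dominates Q -> trace_dominates (fun g => k * Q g).
Proof.
move=> k0 QP y w y0 w0 yw; rewrite -mulr_sumr -!mulrA -mulrDr.
by rewrite ler_wpM2l // QP.
Qed.

Lemma trace_dominates_add Q1 Q2 : trace_dominates Q1 -> trace_dominates Q2 ->
  trace_dominates (fun g => Q1 g + Q2 g).
Proof.
move=> QP1 QP2 y w y0 w0 yw; rewrite big_split /= !mulrDl addrACA.
by rewrite lerD ?QP1 ?QP2.
Qed.

Lemma trace_dominates_ext Q1 Q2 :
  Q1 =1 Q2 -> trace_dominates Q1 -> trace_dominates Q2.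
Proof.
move=> E QP y w y0 w0 yw; rewrite -!E (eq_bigr _ (fun _ _ => esym (E _))).
exact: QP.
Qed.

End TwoVectorTrace.

(** * Skew 1-chains: curl, divergence and boundaries of triangles *)

Section Chains.

Variables (R : realFieldType) (V : finType).
Implicit Types (x y f : V -> V -> R) (W s : {set V}) (F K : {set {set V}}).
Implicit Types (u g : {set V} -> R) (eps : {set V} -> V -> V -> R).

(* A 1-chain is a skew function of two vertices, so [pair_sq] counts each
   edge twice. *)
Definition skew x : Prop := forall a b, x a b = - x b a.

Definition pair_sq W x : R := \sum_(a in W) \sum_(b in W) x a b ^+ 2.

Definition divergence W x (a : V) : R := \sum_(b in W) x a b.

Definition curl x (a b c : V) : R := x a b + x b c + x c a.

Lemma skew_diag x a : skew x -> x a a = 0.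
Proof. by move=> xs; have := xs a a; lra. Qed.

Lemma eq_pair_sq W x y : {in W &, x =2 y} -> pair_sq W x = pair_sq W y.
Proof. by move=> xy; do 2!apply: eq_bigr => ? ?; rewrite xy. Qed.

(** When the square is expanded, each of the three square terms gives [#|W| * pair_sq W x]. The
    three mixed terms agree by cyclic symmetry; summing over the two outer vertices around the
    shared one turns each into minus the sum of squared divergences. *)
Lemma sum_curl_sqr W x : skew x ->
  \sum_(a in W) \sum_(b in W) \sum_(c in W) curl x a b c ^+ 2 =
  3 * #|W|%:R * pair_sq W x - 6 * \sum_(a in W) divergence W x a ^+ 2.
Proof.
move=> xs.
pose G (p q : V -> V -> V -> R) :=
  \sum_(a in W) \sum_(b in W) \sum_(c in W) p a b c * q a b c.
pose p1 a b (c : V) : R := x a b.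
pose p2 (a : V) b c : R := x b c.
pose p3 a (b : V) c : R := x c a.
have -> : \sum_(a in W) \sum_(b in W) \sum_(c in W) curl x a b c ^+ 2 =
    G p1 p1 + G p2 p2 + G p3 p3 + 2 * (G p1 p2 + G p2 p3 + G p3 p1).
  rewrite !mulrDr /G !mulr_sumr -!big_split; apply: eq_bigr => a _ /=.
  rewrite !mulr_sumr -!big_split; apply: eq_bigr => b _ /=.
  rewrite !mulr_sumr -!big_split; apply: eq_bigr => c _ /=.
  by rewrite /curl /p1 /p2 /p3; ring.
have G11 : G p1 p1 = #|W|%:R * pair_sq W x.
  rewrite /G /pair_sq mulr_sumr; apply: eq_bigr => a _.
  rewrite mulr_sumr; apply: eq_bigr => b _.
  by rewrite mulr_natl -sumr_const; apply: eq_bigr => ? _; rewrite expr2.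
have G22 : G p2 p2 = #|W|%:R * pair_sq W x.
  rewrite mulr_natl -sumr_const /G; apply: eq_bigr => a _.
  by do 2!apply: eq_bigr => ? _; rewrite expr2.
have G33 : G p3 p3 = #|W|%:R * pair_sq W x.
  rewrite -G22 /G exchange_big /=; apply: eq_bigr => a _.
  by rewrite exchange_big.
have G12 : G p1 p2 = - \sum_(a in W) divergence W x a ^+ 2.
  rewrite /G exchange_big -sumrN; apply: eq_bigr => b _ /=.
  rewrite expr2 -mulNr /divergence -sumrN mulr_suml; apply: eq_bigr => a _.
  by rewrite mulr_sumr; apply: eq_bigr => c _; rewrite /p1 /p2 (xs a b).
have G23 : G p2 p3 = G p1 p2.
  by rewrite /G exchange_big; apply: eq_bigr => a _; rewrite exchange_big.
have G31 : G p3 p1 = G p2 p3.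
  by rewrite /G exchange_big; apply: eq_bigr => a _; rewrite exchange_big.
rewrite G31 G23 G12 G11 G22 G33; ring.
Qed.

(* [eps s a b] is the coefficient of the oriented edge [(a, b)] in the boundary
   of [s]. *)
Definition orientation K eps : Prop := forall s, s \in K ->
  [/\ skew (eps s),
      forall a b, eps s a b ^+ 2 = [&& a != b, a \in s & b \in s]%:R &
      forall a, \sum_(b in s) eps s a b = 0].

Definition bd eps F u (a b : V) : R := \sum_(s in F) u s * eps s a b.

Definition pairing W x y : R := \sum_(a in W) \sum_(b in W) x a b * y a b.

Lemma card3_elements s : #|s| = 3%N ->
  exists i j k, [/\ i != j, i != k, j != k & s = [set i; j; k]].
Proof.
move/eqP; have [[|i [|j [|k []]]]//=] := cards_eqP.
rewrite !inE negb_or andbT => /andP[/andP[ij ik] jk] _.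
by exists i, j, k; split => //; apply/setP => a; rewrite !inE orbA.
Qed.

Lemma big_set3 (f : V -> R) i j k : i != j -> i != k -> j != k ->
  \sum_(a in [set i; j; k]) f a = f i + f j + f k.
Proof.
move=> ij ik jk; rewrite -setUA big_setU1 ?inE ?negb_or ?ij //=.
by rewrite big_setU1 ?inE //= big_set1 addrA.
Qed.

(** As [pairing] counts each edge twice, it is twice the curl up to sign. The ordered triples in [s]
    contribute 6 squared curls, the degenerate ones nothing; hence 4 * 3 = 2 * 6. *)
Lemma pairing_triangle K eps s x : orientation K eps -> s \in K ->
  #|s| = 3%N -> skew x ->
  pairing s (eps s) x ^+ 2 * 3 =
  2 * \sum_(a in s) \sum_(b in s) \sum_(c in s) curl x a b c ^+ 2.
Proof.
move=> Ho sK /card3_elements[i [j [k [ij ik jk sE]]]] xs.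
have [es e2 e0] := Ho s sK.
have s3 : #|s| = 3%N.
  by rewrite sE -setUA cardsU1 cards2 !inE negb_or ij ik jk.
have t2 : eps s i j ^+ 2 = 1 by rewrite e2 sE !inE ij !eqxx orbT.
have S3 (h : V -> R) : \sum_(a in s) h a = h i + h j + h k.
  by rewrite sE big_set3.
have ri := e0 i; have rj := e0 j; rewrite !S3 !(skew_diag _ es) in ri rj.
have eik : eps s i k = - eps s i j by lra.
have ejk : eps s j k = eps s i j by have := es j i; lra.
rewrite sum_curl_sqr // /pair_sq /divergence /pairing s3 !S3.
rewrite !(skew_diag _ es) !(skew_diag _ xs) (es j i) (es k i) (es k j).
rewrite (xs j i) (xs k i) (xs k j) eik ejk.
transitivity (12 * eps s i j ^+ 2 * (x i j + x j k - x i k) ^+ 2); first by ring.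
by rewrite t2; ring.
Qed.

Lemma orientation_eq0 K eps s a b : orientation K eps -> s \in K ->
  ~~ [&& a != b, a \in s & b \in s] -> eps s a b = 0.
Proof.
move=> Ho /Ho[_ e2 _] /negPf abs.
by apply/eqP; rewrite -sqrf_eq0 e2 abs.
Qed.

Lemma sum_supported W s (h : V -> R) : s \subset W ->
  (forall a, a \notin s -> h a = 0) -> \sum_(a in W) h a = \sum_(a in s) h a.
Proof.
move=> sW h0; rewrite (big_setID s) /= (setIidPr sW) [X in _ + X]big1 ?addr0 //.
by move=> a; rewrite inE => /andP[/h0].
Qed.

Lemma pairing_restrict K eps s W x : orientation K eps -> s \in K ->
  s \subset W -> pairing W (eps s) x = pairing s (eps s) x.
Proof.
move=> Ho sK sW; rewrite /pairing (sum_supported sW) => [|a aNs].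
  apply: eq_bigr => a _; apply: sum_supported => // b bNs.
  by rewrite (orientation_eq0 Ho) ?mul0r // (negPf bNs) !andbF.
apply: big1 => b _.
by rewrite (orientation_eq0 Ho) ?mul0r // (negPf aNs) andbF.
Qed.

Lemma curl_sqr_distinct x a b c : skew x -> curl x a b c != 0 ->
  [/\ a != b, a != c & b != c].
Proof.
move=> xs; rewrite /curl => n0; split; apply: contra_neq n0 => ->;
  rewrite (skew_diag _ xs).
- by rewrite (xs b c); ring.
- by rewrite (xs c b); ring.
- by rewrite (xs c a); ring.
Qed.

(** Distinct triangles share no ordered triple of distinct vertices, and all other triples have zero
    curl. So the sum is at most the one over all triples in [W], which [sum_curl_sqr] evaluates. *)
Lemma sum_pairing_sqr K eps W F x : orientation K eps ->
  (forall s, s \in K -> #|s| = 3%N) -> skew x ->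
  F \subset K -> (forall s, s \in F -> s \subset W) ->
  \sum_(s in F) pairing W (eps s) x ^+ 2 <=
  2 * #|W|%:R * pair_sq W x - 4 * \sum_(a in W) divergence W x a ^+ 2.
Proof.
move=> Ho K3 xs FK FW.
suff : \sum_(s in F) pairing W (eps s) x ^+ 2 * 3 <=
    2 * \sum_(a in W) \sum_(b in W) \sum_(c in W) curl x a b c ^+ 2.
  by rewrite -mulr_suml sum_curl_sqr //; lra.
have -> : \sum_(s in F) pairing W (eps s) x ^+ 2 * 3 =
  2 * \sum_(s in F) \sum_(a in s) \sum_(b in s) \sum_(c in s) curl x a b c ^+ 2.
  rewrite mulr_sumr; apply: eq_bigr => s sF.
  have sK := subsetP FK _ sF.
  rewrite -(pairing_triangle Ho sK (K3 _ sK) xs).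
  by rewrite (pairing_restrict _ Ho) ?FW.
rewrite ler_pM2l ?ltr0n //.
rewrite (exchange_big_dep (mem W)) /= => [|s a /FW/subsetP sW /sW //].
apply: ler_sum => a _.
rewrite (exchange_big_dep (mem W)) /= => [|s b /andP[/FW/subsetP sW _] /sW //].
apply: ler_sum => b _.
rewrite (exchange_big_dep (mem W)) /=
  => [|s c /andP[/andP[/FW/subsetP sW _] _] /sW //].
apply: ler_sum => c _.
have [->|n0] := eqVneq (curl x a b c) 0.
  by rewrite big1 // expr0n.
have [ab ac bc] := curl_sqr_distinct xs n0.
have sE s : (((s \in F) && (a \in s)) && (b \in s)) && (c \in s) ->
    s = [set a; b; c].
  move=> /andP[/andP[/andP[sF sa] sb] sc]; apply/esym/eqP; rewrite eqEcard.
  rewrite (K3 _ (subsetP FK _ sF)) !subUset !sub1set sa sb sc.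
  by rewrite -setUA cardsU1 cards2 !inE negb_or ab ac bc.
rewrite sumr_const -mulr_natl -[leRHS]mul1r ler_wpM2r ?sqr_ge0 // lern1.
rewrite -(cards1 [set a; b; c]) subset_leq_card //.
by apply/subsetP => s; rewrite inE => /sE ->.
Qed.

Lemma pairing_bd W eps F u y :
  pairing W (bd eps F u) y = \sum_(s in F) u s * pairing W (eps s) y.
Proof.
rewrite /pairing; under [RHS]eq_bigr => s _ do rewrite mulr_sumr.
rewrite [RHS]exchange_big; apply: eq_bigr => a _ /=.
under [RHS]eq_bigr => s _ do rewrite mulr_sumr.
rewrite [RHS]exchange_big; apply: eq_bigr => b _ /=.
by rewrite mulr_suml; apply: eq_bigr => s _; rewrite mulrA.
Qed.

Lemma pair_sq_pairing W x : pair_sq W x = pairing W x x.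
Proof. by do 2!apply: eq_bigr => ? _; rewrite expr2. Qed.

Lemma skew_bd K eps F u : orientation K eps -> F \subset K ->
  skew (bd eps F u).
Proof.
move=> Ho FK a b; rewrite /bd -sumrN; apply: eq_bigr => s sF.
by have [-> _ _] := Ho s (subsetP FK _ sF); rewrite mulrN.
Qed.

(* Cauchy-Schwarz, in the form [0 <= |2 m u - bd^T (bd u)|^2]. *)
Lemma pair_sq_bd_le K eps W F u : orientation K eps ->
  (forall s, s \in K -> #|s| = 3%N) ->
  F \subset K -> (forall s, s \in F -> s \subset W) ->
  pair_sq W (bd eps F u) <= 2 * #|W|%:R * sqnorm F u.
Proof.
move=> Ho K3 FK FW; set x := bd _ _ _; set m : R := #|W|%:R.
have [W0|W0] := posnP #|W|.
  by rewrite /m W0 mulr0 mul0r /pair_sq (cards0_eq W0) big_set0.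
have m0 : 0 < m by rewrite ltr0n.
have xs : skew x by exact: skew_bd Ho FK.
have := sum_pairing_sqr Ho K3 xs FK FW; rewrite -/m.
have : 0 <= \sum_(a in W) divergence W x a ^+ 2.
  by apply: sumr_ge0 => a _; exact: sqr_ge0.
have : 0 <= \sum_(s in F) (2 * m * u s - pairing W (eps s) x) ^+ 2.
  by apply: sumr_ge0 => a _; exact: sqr_ge0.
have -> : \sum_(s in F) (2 * m * u s - pairing W (eps s) x) ^+ 2 =
   (2 * m) ^+ 2 * sqnorm F u + \sum_(s in F) pairing W (eps s) x ^+ 2
    - 4 * m * pair_sq W x.
  rewrite pair_sq_pairing {3}/x pairing_bd /sqnorm !mulr_sumr -sumrN -!big_split.
  by apply: eq_bigr => s _ /=; ring.
move=> h1 h2 h3; rewrite -(ler_pM2l m0) -(ler_pM2l (ltr0n R 2)).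
by nra.
Qed.

(* The cross term [2 <u, bd^T f>] is absorbed by AM-GM with weight
   [mu - #|W|]. *)
Lemma pair_sq_add_bd_le K eps W F u f (mu : R) : orientation K eps ->
  (forall s, s \in K -> #|s| = 3%N) ->
  F \subset K -> (forall s, s \in F -> s \subset W) -> skew f ->
  #|W|%:R < mu ->
  (mu - #|W|%:R) * pair_sq W (fun a b => bd eps F u a b + f a b) <=
  2 * mu * (mu - #|W|%:R) * sqnorm F u + mu * pair_sq W f
  - 2 * \sum_(a in W) divergence W f a ^+ 2.
Proof.
move=> Ho K3 FK FW fs mmu; set m : R := #|W|%:R in mmu *.
have := sum_pairing_sqr Ho K3 fs FK FW; rewrite -/m.
have := pair_sq_bd_le u Ho K3 FK FW; rewrite -/m.
have -> : pair_sq W (fun a b => bd eps F u a b + f a b) =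
    pair_sq W (bd eps F u) + pair_sq W f + 2 * pairing W (bd eps F u) f.
  rewrite /pair_sq /pairing mulr_sumr -!big_split; apply: eq_bigr => a _ /=.
  by rewrite mulr_sumr -!big_split; apply: eq_bigr => b _ /=; ring.
have : 0 <= \sum_(s in F) (2 * (mu - m) * u s - pairing W (eps s) f) ^+ 2.
  by apply: sumr_ge0 => a _; exact: sqr_ge0.
have -> : \sum_(s in F) (2 * (mu - m) * u s - pairing W (eps s) f) ^+ 2 =
   (2 * (mu - m)) ^+ 2 * sqnorm F u + \sum_(s in F) pairing W (eps s) f ^+ 2
    - 4 * (mu - m) * pairing W (bd eps F u) f.
  rewrite pairing_bd /sqnorm !mulr_sumr -sumrN -!big_split.
  by apply: eq_bigr => s _ /=; ring.
set A := sqnorm F u; set B := pairing _ _ _; set C := pair_sq _ _.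
set D := pair_sq _ _; set E := \sum_(a in W) _; set G := \sum_(s in F) _.
move=> h1 h2 h3.
have : (mu - m) * C <= (mu - m) * (2 * m * A) by rewrite ler_pM2l ?subr_gt0.
nra.
Qed.

End Chains.

(** * Leaf triangles and the elimination of the core triangles *)

Section LeafTriangles.

Variables (R : realFieldType) (V : finType) (K : {set {set V}}).
Variable eps : {set V} -> V -> V -> R.
Hypotheses (Ho : orientation K eps) (K3 : forall s, s \in K -> #|s| = 3%N).
Implicit Types (s t : {set V}) (u g y : {set V} -> R).

Definition core : {set V} := [set v | (2 <= deg K v)%N].
Definition core_triangles : {set {set V}} := [set s in K | s \subset core].
Definition leaf_triangles : {set {set V}} := [set s in K | ~~ (s \subset core)].

Local Notation W := core.
Local Notation F := core_triangles.
Local Notation T := leaf_triangles.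

Lemma leaf_in_K s : s \in T -> s \in K.
Proof. by rewrite inE => /andP[]. Qed.

Lemma leaf_vertex_triangle v s t :
  v \notin W -> s \in K -> t \in K -> v \in s -> v \in t -> s = t.
Proof.
rewrite inE -ltnNge ltnS => d1 sK tK vs vt; apply/eqP.
apply: contraTT d1 => st; rewrite -ltnNge.
have <- : #|[set s; t]| = 2%N by rewrite cards2 st.
by apply/subset_leq_card/subsetP => r; rewrite !inE => /orP[]/eqP ->; apply/andP.
Qed.

Lemma bd_split u a b : bd eps K u a b = bd eps F u a b + bd eps T u a b.
Proof.
rewrite /bd (bigID (fun s => s \subset W)) /=.
by congr (_ + _); apply: eq_bigl => s; rewrite inE.
Qed.

Lemma sqnorm_split u : sqnorm K u = sqnorm F u + sqnorm T u.
Proof.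
rewrite /sqnorm (bigID (fun s => s \subset W)) /=.
by congr (_ + _); apply: eq_bigl => s; rewrite inE.
Qed.

Lemma pair_sq_setT (x : V -> V -> R) : pair_sq setT x =
  pair_sq W x + \sum_a \sum_(b | ~~ ((a \in W) && (b \in W))) x a b ^+ 2.
Proof.
rewrite /pair_sq (eq_bigl predT) => [|a]; last by rewrite inE.
rewrite [X in X + _]big_mkcond -big_split; apply: eq_bigr => a _ /=.
rewrite (eq_bigl predT) => [|b]; last by rewrite inE.
case: (a \in W) => /=; first by rewrite (bigID (mem W)).
by rewrite add0r.
Qed.

Lemma orientation_mem s a b : s \in K -> eps s a b != 0 ->
  [/\ a != b, a \in s & b \in s].
Proof.
move=> sK n0; apply/and3P; apply: contraNT n0 => h.
by rewrite (orientation_eq0 Ho).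
Qed.

(** Three edges, each counted in both orders. *)
Lemma pair_sq_setT_eps s : s \in K -> pair_sq setT (eps s) = 6.
Proof.
move=> sK; have [i [j [k [ij ik jk sE]]]] := card3_elements (K3 sK).
have S3 (h : V -> R) : \sum_(a in s) h a = h i + h j + h k.
  by rewrite sE big_set3.
have [_ e2 _] := Ho sK.
have sT : s \subset setT by exact: subsetT.
rewrite /pair_sq (sum_supported sT) => [|a aNs].
  transitivity (\sum_(a in s) \sum_(b in s) (a != b)%:R : R).
    apply: eq_bigr => a sa; rewrite (sum_supported sT) => [|b bNs].
      by apply: eq_bigr => b sb; rewrite e2 sa sb !andbT.
    by rewrite e2 (negPf bNs) !andbF.
  rewrite !S3 [j == i]eq_sym [k == i]eq_sym [k == j]eq_sym.
  by rewrite ij ik jk !eqxx /=; ring.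
by apply: big1 => b _; rewrite e2 (negPf aNs) andbF.
Qed.

(** A pair of vertices not both in the core lies in at most one triangle, which is then a leaf
    triangle. Outside the core the form is therefore diagonal. *)
Lemma pair_sq_bd_split u : pair_sq setT (bd eps K u) =
  pair_sq W (bd eps K u) + \sum_(s in T) (6 - pair_sq W (eps s)) * u s ^+ 2.
Proof.
rewrite pair_sq_setT; congr (_ + _).
transitivity (\sum_(s in T) \sum_a \sum_(b | ~~ ((a \in W) && (b \in W)))
    (u s * eps s a b) ^+ 2).
  rewrite [RHS]exchange_big; apply: eq_bigr => a _ /=.
  rewrite [RHS]exchange_big; apply: eq_bigr => b /= abW.
  have -> : bd eps K u a b = bd eps T u a b.
    rewrite bd_split [X in X + _]big1 ?add0r // => s; rewrite inE.
    move=> /andP[sK /subsetP sW]; apply/eqP; apply: contraNT abW.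
    rewrite mulf_eq0 negb_or => /andP[_ /(orientation_mem sK)[_ /sW -> /sW ->]].
    by [].
  apply: sqr_sum_single => s t /leaf_in_K sK /leaf_in_K tK.
  rewrite !mulf_eq0 !negb_or => /andP[_ /(orientation_mem sK)[_ sa sb]].
  move=> /andP[_ /(orientation_mem tK)[_ ta tb]].
  move: abW; rewrite negb_and => /orP[vW|vW].
    exact: (leaf_vertex_triangle vW).
  exact: (leaf_vertex_triangle vW).
apply: eq_bigr => s /leaf_in_K sK.
rewrite -(pair_sq_setT_eps sK) pair_sq_setT addrC addrA addNr add0r.
rewrite mulr_suml; apply: eq_bigr => a _.
by rewrite mulr_suml; apply: eq_bigr => b _; rewrite exprMn mulrC.
Qed.

(** The elementary 1-chain of the oriented edge [(a, b)]. *)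
Definition edge_form (a b a' b' : V) : R :=
  (a' == a)%:R * (b' == b)%:R - (a' == b)%:R * (b' == a)%:R.

Lemma sum_delta a (h : V -> R) : a \in W ->
  \sum_(b in W) (b == a)%:R * h b = h a.
Proof.
move=> aW; rewrite (bigD1 a) //= eqxx mul1r big1 ?addr0 //.
by move=> b /andP[_ /negPf ->]; rewrite mul0r.
Qed.

Lemma sum_delta1 a : a \in W -> \sum_(b in W) (b == a)%:R = 1 :> R.
Proof.
move=> aW; rewrite -[RHS](sum_delta (fun=> 1) aW).
by apply: eq_bigr => b _; rewrite mulr1.
Qed.

(** The single edge is counted twice, and the divergence is [k] at [a], [- k] at [b] and 0
    elsewhere. *)
Lemma edge_form_sums a b (k : R) (x : V -> V -> R) :
  a \in W -> b \in W -> a != b ->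
  {in W &, forall a' b', x a' b' = k * edge_form a b a' b'} ->
  pair_sq W x = 2 * k ^+ 2 /\ \sum_(c in W) divergence W x c ^+ 2 = 2 * k ^+ 2.
Proof.
move=> aW bW ab xE.
have dE (c : V) : (c == a)%:R * (c == b)%:R = 0 :> R.
  by case: eqP => [->|]; rewrite ?mul0r // (negPf ab) mulr0.
split.
  transitivity (\sum_(c in W) k ^+ 2 * ((c == a)%:R + (c == b)%:R)).
    apply: eq_bigr => c cW.
    transitivity (\sum_(d in W) k ^+ 2 * ((c == a)%:R * (d == b)%:R
      + (c == b)%:R * (d == a)%:R)).
      apply: eq_bigr => d dW; rewrite xE // /edge_form.
      by have := dE c; case: (c == a); case: (c == b);
        case: (d == a); case: (d == b) => /=; rewrite ?(mulr0, mulr1) => h;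
        try ring; move/eqP: h; rewrite oner_eq0.
    rewrite -mulr_sumr big_split /= -!mulr_sumr.
    by rewrite !sum_delta1 // !mulr1.
  by rewrite -mulr_sumr big_split /= !sum_delta1 //; ring.
transitivity (\sum_(c in W) k ^+ 2 * ((c == a)%:R + (c == b)%:R)).
  apply: eq_bigr => c cW.
  have -> : divergence W x c = k * ((c == a)%:R - (c == b)%:R).
    transitivity (\sum_(d in W) k * edge_form a b c d).
      by apply: eq_bigr => d dW; rewrite xE.
    rewrite -mulr_sumr /edge_form sumrB -!mulr_sumr.
    by rewrite !sum_delta1 // !mulr1.
  by have := dE c; case: (c == a); case: (c == b) => /=;
    rewrite ?(mulr0, mulr1) => h; try ring; move/eqP: h; rewrite oner_eq0.
by rewrite -mulr_sumr big_split /= !sum_delta1 //; ring.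
Qed.

(** A leaf triangle has at most two vertices in the core, so [{a, b}] is its only edge there. *)
Lemma leaf_eps_edge s a b : s \in T -> a \in W -> b \in W -> a != b ->
  a \in s -> b \in s ->
  {in W &, forall a' b', eps s a' b' = eps s a b * edge_form a b a' b'}.
Proof.
move=> sT aW bW ab sa sb a' b' aW' bW'; have sK := leaf_in_K sT.
have [es e2 _] := Ho sK.
have sWE : s :&: W = [set a; b].
  apply/eqP; rewrite eq_sym eqEcard cards2 ab subUset !sub1set !inE sa sb.
  move: aW bW; rewrite !inE => -> -> /=.
  rewrite -ltnS -(K3 sK) proper_card // properEneq subsetIl andbT.
  by apply/eqP => /setIidPl sW; move: sT; rewrite inE sW andbF.
have mem c : c \in s -> c \in W -> (c == a) || (c == b).
  by move=> sc cW; rewrite -!in_set1 -in_setU -sWE inE sc.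
have ba : (b == a) = false by rewrite eq_sym (negPf ab).
rewrite /edge_form; have [z|n0] := eqVneq (eps s a' b') 0.
  rewrite z; apply/esym/eqP; rewrite mulf_eq0; apply/orP; right.
  have nz : eps s a b != 0 by rewrite -sqrf_eq0 e2 ab sa sb oner_eq0.
  have [aE|_] := eqVneq a' a; have [bE|_] := eqVneq b' b => /=.
  - by move: nz; rewrite -aE -bE z eqxx.
  - by rewrite aE (negPf ab) !mul0r mulr0 subrr.
  - by rewrite bE ba !mulr0 mul0r subrr.
  - have [aE|_] := eqVneq a' b; have [bE|_] := eqVneq b' a => /=;
      rewrite ?mulr0 ?mul0r ?subrr //.
    by move: nz; rewrite es -aE -bE z oppr0 eqxx.
have [ab' sa' sb'] := orientation_mem sK n0.
case/orP: (mem _ sa' aW') => /eqP aE; case/orP: (mem _ sb' bW') => /eqP bE;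
  move: ab'; rewrite aE bE ?eqxx // => _; rewrite ?(negPf ab) ?ba ?eqxx.
- by rewrite mul1r mul0r subr0 mulr1.
- by rewrite [LHS]es !mul0r sub0r mulr1 mulrN mulr1.
Qed.

(** The two values correspond to a leaf triangle with no edge or exactly one edge inside the
    core. *)
Lemma leaf_eps_sums s : s \in T ->
  \sum_(a in W) divergence W (eps s) a ^+ 2 = pair_sq W (eps s) /\
  (pair_sq W (eps s) = 0 \/ pair_sq W (eps s) = 2).
Proof.
move=> sT; have sK := leaf_in_K sT; have [_ e2 _] := Ho sK.
have [/existsP[a /existsP[b /and5P[aW bW ab sa sb]]]|h] :=
  boolP [exists a, exists b, [&& a \in W, b \in W, a != b, a \in s & b \in s]].
  have [-> ->] := edge_form_sums aW bW ab (leaf_eps_edge sT aW bW ab sa sb).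
  by rewrite e2 ab sa sb mulr1; split => //; right.
have z : {in W &, forall a b, eps s a b = 0}.
  move=> a b aW bW; apply/eqP; apply: contraNT h => /(orientation_mem sK)[ab sa sb].
  by apply/existsP; exists a; apply/existsP; exists b; apply/and5P.
have -> : pair_sq W (eps s) = 0.
  by apply: big1 => a aW; apply: big1 => b bW; rewrite z ?expr0n.
split; last by left.
by apply: big1 => a aW; rewrite /divergence big1 ?expr0n // => b bW; rewrite z.
Qed.

(* What remains, up to a factor depending on [mu], of the quadratic form of the
   triangle Laplacian minus [mu] once the core triangles are eliminated, with
   the complete 3-family on the core substituted for them; doubled, like
   [pair_sq]. *)
Definition schur_form (mu : R) (g : {set V} -> R) : R :=
  mu * pair_sq W (bd eps T g)
  - 2 * \sum_(a in W) divergence W (bd eps T g) a ^+ 2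
  + (mu - 2) * \sum_(s in T) (2 - pair_sq W (eps s)) * g s ^+ 2.

Lemma leaf_subset : T \subset K.
Proof. by apply/subsetP => s; exact: leaf_in_K. Qed.

Lemma core_subset : F \subset K.
Proof. by apply/subsetP => s; rewrite inE => /andP[]. Qed.

Lemma core_in_W s : s \in F -> s \subset W.
Proof. by rewrite inE => /andP[]. Qed.

Lemma leaf_pair_sq_le2 s : s \in T -> 0 <= 2 - pair_sq W (eps s).
Proof. by case/leaf_eps_sums => _ [] ->; lra. Qed.

(** Multiply the hypothesis by [mu - #|W|] and bound its core part by [pair_sq_add_bd_le]: the terms
    in [sqnorm F u] cancel. *)
Lemma schur_form_ge u (mu : R) : 2 <= #|W|%:R :> R -> #|W|%:R < mu ->
  2 * mu * sqnorm K u <= pair_sq setT (bd eps K u) ->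
  2 * (mu - #|W|%:R) * (mu - 2) * sqnorm T u <= schur_form mu u.
Proof.
set m : R := #|W|%:R => m2 mmu.
rewrite pair_sq_bd_split (eq_pair_sq (fun a b _ _ => bd_split u a b)).
rewrite sqnorm_split.
have := pair_sq_add_bd_le u Ho K3 core_subset core_in_W
  (skew_bd u Ho leaf_subset) mmu.
rewrite -/m /schur_form.
(* A leaf triangle has at least two edges outside the core, whence the 4. *)
have -> : \sum_(s in T) (6 - pair_sq W (eps s)) * u s ^+ 2 =
   4 * sqnorm T u + \sum_(s in T) (2 - pair_sq W (eps s)) * u s ^+ 2.
  by rewrite mulr_sumr -big_split; apply: eq_bigr => s _ /=; ring.
have : 0 <= \sum_(s in T) (2 - pair_sq W (eps s)) * u s ^+ 2.
  by apply: sumr_ge0 => s sT; rewrite mulr_ge0 ?sqr_ge0 ?leaf_pair_sq_le2.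
set A := pair_sq W (fun _ => _); set B := sqnorm F u; set C := pair_sq W _.
set D := \sum_(a in W) _; set E := sqnorm T u; set G := \sum_(s in T) _.
move=> G0 h1 h2.
have h3 : (mu - m) * (2 * mu * (B + E)) <= (mu - m) * (A + (4 * E + G)).
  by rewrite ler_pM2l ?subr_gt0.
(* As [2 <= m], the weight [mu - m] of [G] can be raised to [mu - 2], which makes the diagonal of
   [schur_form] constant. *)
have h4 : 0 <= (m - 2) * G by rewrite mulr_ge0 ?subr_ge0.
nra.
Qed.

(** A [u] that vanishes on the leaf triangles lives on the core, where the form is at most
    [2 * #|W| * sqnorm F u]. *)
Lemma leaf_part_neq0 u (mu : R) : #|W|%:R < mu ->
  2 * mu * sqnorm K u <= pair_sq setT (bd eps K u) ->
  0 < sqnorm K u -> 0 < sqnorm T u.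
Proof.
move=> mmu; rewrite lt_neqAle sqnorm_ge0 andbT => h u0.
rewrite lt_neqAle sqnorm_ge0 andbT; apply: contra_neq u0 => /esym z.
have uT s : s \in T -> u s = 0.
  move=> sT; apply/eqP; rewrite -sqrf_eq0; apply/eqP.
  by apply: (psumr_eq0P _ z) => // t _; exact: sqr_ge0.
move: h; rewrite pair_sq_bd_split sqnorm_split z addr0.
rewrite [X in _ + X]big1 => [|s /uT ->]; last by rewrite expr0n mulr0.
rewrite (eq_pair_sq (y := bd eps F u)) => [|a b _ _]; last first.
  by rewrite bd_split [X in _ + X]big1 ?addr0 // => s /uT ->; rewrite mul0r.
have := pair_sq_bd_le u Ho K3 core_subset core_in_W.
have := sqnorm_ge0 F u; nra.
Qed.

Lemma schur_form_delta mu s : s \in T ->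
  schur_form mu (fun t => (t == s)%:R) = 2 * (mu - 2).
Proof.
move=> sT.
have bE a b : bd eps T (fun t => (t == s)%:R) a b = eps s a b.
  rewrite /bd (bigD1 s) //= eqxx mul1r big1 ?addr0 //.
  by move=> t /andP[_ /negPf ->]; rewrite mul0r.
rewrite /schur_form (eq_pair_sq (y := eps s)) => [|a b _ _]; last exact: bE.
have -> : \sum_(a in W) divergence W (bd eps T (fun t => (t == s)%:R)) a ^+ 2
    = \sum_(a in W) divergence W (eps s) a ^+ 2.
  by apply: eq_bigr => a _; congr (_ ^+ 2); apply: eq_bigr => b _; exact: bE.
rewrite (bigD1 s sT) /= eqxx [X in _ * (_ + X)]big1 => [|t]; last first.
  case/andP=> _ /negPf ->.
  by rewrite expr0n mulr0.
by have [-> [] ->] := leaf_eps_sums sT; rewrite /=; ring.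
Qed.

(** The form is a nonnegative combination of squares of linear forms: by [sum_curl_sqr], a third of
    the sum of squared curls supplies [#|W| * pair_sq] minus twice the squared divergences, which
    leaves the weight [mu - #|W|] on [pair_sq]. *)
Lemma schur_form_trace (mu : R) : 2 <= mu -> #|W|%:R <= mu ->
  trace_dominates T (schur_form mu).
Proof.
move=> mu2 mmu.
pose Q g : R := (mu - #|W|%:R) * pair_sq W (bd eps T g)
  + (3^-1 * \sum_(a in W) \sum_(b in W) \sum_(c in W) curl (bd eps T g) a b c ^+ 2
  + (mu - 2) * \sum_(s in T) (2 - pair_sq W (eps s)) * g s ^+ 2).
apply: (@trace_dominates_ext _ _ _ Q) => [g|].
  rewrite /Q sum_curl_sqr; last exact: skew_bd Ho leaf_subset.
  rewrite /schur_form; set S := \sum_(s in T) _; set D := \sum_(a in W) _.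
  by field.
apply: trace_dominates_add.
  apply: trace_dominates_scale; first by rewrite subr_ge0.
  apply: trace_dominates_sum => a _; apply: trace_dominates_sum => b _.
  apply: (@trace_dominates_sqr _ _ _ (fun s => eps s a b)) => g.
  by congr (_ ^+ 2); apply: eq_bigr => s _; rewrite mulrC.
apply: trace_dominates_add.
  apply: trace_dominates_scale; first by rewrite invr_ge0 ler0n.
  apply: trace_dominates_sum => a _; apply: trace_dominates_sum => b _.
  apply: trace_dominates_sum => c _.
  apply: (@trace_dominates_sqr _ _ _ (fun s => curl (eps s) a b c)) => g.
  congr (_ ^+ 2); rewrite /curl /bd -!big_split /=.
  by apply: eq_bigr => s _; ring.
apply: trace_dominates_scale; first by rewrite subr_ge0.
apply: trace_dominates_sum => s sT.
apply: trace_dominates_scale; first exact: leaf_pair_sq_le2.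
apply: (@trace_dominates_sqr _ _ _ (fun t => (t == s)%:R)) => g.
rewrite (bigD1 s sT) /= eqxx mul1r big1 ?addr0 //.
by move=> t /andP[_ /negPf ->]; rewrite mul0r.
Qed.

(* [schur_form] is affine in [mu]; testing the hypothesis on the leaf triangles
   at a single edge shows that its slope at [g] is at most
   [2 * alpha * sqnorm T g]. *)
Lemma schur_form_le_mono (mu nu alpha : R) g : 2 < mu -> mu <= nu ->
  (forall y, 0 < sqnorm T y ->
    schur_form mu y < 2 * (mu - 2) * alpha * sqnorm T y) ->
  0 < sqnorm T g -> schur_form nu g < 2 * (nu - 2) * alpha * sqnorm T g.
Proof.
move=> mu2 mnu H g0.
(* Test on a single leaf triangle, where the form is [2 * (mu - 2)]. *)
have alpha1 : 1 <= alpha.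
  have [s sT] : exists s, s \in T.
    apply/set0Pn; apply: contraTneq g0 => T0.
    by rewrite /sqnorm T0 big_set0 ltxx.
  have sq : sqnorm T (fun t => (t == s)%:R) = 1 :> R.
    rewrite /sqnorm (bigD1 s sT) /= eqxx big1 ?addr0 ?expr1n //.
    by move=> t /andP[_ /negPf ->]; rewrite expr0n.
  have := H (fun t => (t == s)%:R); rewrite sq ltr01 schur_form_delta // mulr1.
  move=> /(_ isT); rewrite -mulrA ltr_pM2l ?ltr0n //.
  by rewrite ltr_pMr ?subr_gt0 // => /ltW.
have edge a b : a \in W -> b \in W ->
    bd eps T g a b ^+ 2 <= alpha * \sum_(s in T) eps s a b ^+ 2 * g s ^+ 2.
  move=> aW bW; have fs := skew_bd g Ho leaf_subset.
  have [->|ab] := eqVneq a b.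
    rewrite skew_diag // expr0n mulr_ge0 //; first exact: le_trans ler01 _.
    by apply: sumr_ge0 => s _; rewrite mulr_ge0 ?sqr_ge0.
  (* [y] keeps only the leaf triangles on the edge [{a, b}]. Its boundary inside the core is a
     multiple of that edge, so [schur_form mu y] is [2 * (mu - 2)] times the squared coefficient. *)
  pose y s : R := ((a \in s) && (b \in s))%:R * g s.
  have -> : \sum_(s in T) eps s a b ^+ 2 * g s ^+ 2 = sqnorm T y.
    apply: eq_bigr => s /leaf_in_K /Ho[_ -> _]; rewrite ab /y /=.
    by case: (_ && _); rewrite ?mul0r ?mul1r // expr0n.
  have fE : {in W &, forall a' b',
      bd eps T y a' b' = bd eps T g a b * edge_form a b a' b'}.
    move=> a' b' aW' bW'; rewrite /bd mulr_suml; apply: eq_bigr => s sT.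
    have [/andP[sa sb]|sab] := boolP ((a \in s) && (b \in s)).
      by rewrite /y sa sb mul1r (leaf_eps_edge sT aW bW) // mulrA.
    rewrite /y (negPf sab) !mul0r (orientation_eq0 Ho) ?leaf_in_K ?mulr0 ?mul0r //.
    by rewrite ab.
  have [P D] := edge_form_sums aW bW ab fE.
  have e2 s : s \in T -> (2 - pair_sq W (eps s)) * y s ^+ 2 = 0.
    move=> sT; rewrite /y; case: (boolP (_ && _)) => [/andP[sa sb]|_]; last first.
      by rewrite mul0r expr0n mulr0.
    have [-> _] := edge_form_sums aW bW ab (leaf_eps_edge sT aW bW ab sa sb).
    have [_ -> _] := Ho (leaf_in_K sT).
    by rewrite ab sa sb mulr1 subrr mul0r.
  have [y0|] := ltrP 0 (sqnorm T y).
    have := H y y0; rewrite /schur_form P D [X in (mu - 2) * X]big1 //.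
    rewrite mulr0 addr0 => h.
    have m20 : 0 < mu - 2 by rewrite subr_gt0.
    by rewrite -(ler_pM2l m20); lra.
  move=> y0; have z : sqnorm T y = 0.
    by apply/eqP; rewrite eq_le y0 sqnorm_ge0.
  rewrite z mulr0.
  have yT s : s \in T -> y s = 0.
    move=> sT; apply/eqP; rewrite -sqrf_eq0; apply/eqP.
    by apply: (psumr_eq0P _ z) => // t _; exact: sqr_ge0.
  have := fE a b aW bW; rewrite /bd (eq_bigr (fun=> 0)) => [|s /yT ->]; last first.
    by rewrite mul0r.
  rewrite big1 // /edge_form !eqxx (negPf ab) mul0r subr0 !mulr1 => <-.
  by rewrite expr0n.
(* The left side is the derivative of [schur_form] in [mu]. Triangles with a core edge are handled
   by summing [edge], the others by [1 <= alpha]. *)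
have slope : pair_sq W (bd eps T g)
    + \sum_(s in T) (2 - pair_sq W (eps s)) * g s ^+ 2 <= 2 * alpha * sqnorm T g.
  have : pair_sq W (bd eps T g) <=
      alpha * \sum_(s in T) pair_sq W (eps s) * g s ^+ 2.
    have -> : \sum_(s in T) pair_sq W (eps s) * g s ^+ 2 =
      \sum_(a in W) \sum_(b in W) \sum_(s in T) eps s a b ^+ 2 * g s ^+ 2.
      under eq_bigr => s _ do rewrite /pair_sq mulr_suml.
      rewrite exchange_big; apply: eq_bigr => a _ /=.
      under eq_bigr => s _ do rewrite mulr_suml.
      by rewrite exchange_big.
    rewrite mulr_sumr; apply: ler_sum => a aW.
    by rewrite mulr_sumr; apply: ler_sum => b bW; exact: edge.
  have : sqnorm T g * 2 = \sum_(s in T) pair_sq W (eps s) * g s ^+ 2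
      + \sum_(s in T) (2 - pair_sq W (eps s)) * g s ^+ 2.
    by rewrite mulr_suml -big_split; apply: eq_bigr => s _ /=; ring.
  have : 0 <= \sum_(s in T) (2 - pair_sq W (eps s)) * g s ^+ 2.
    by apply: sumr_ge0 => s sT; rewrite mulr_ge0 ?sqr_ge0 ?leaf_pair_sq_le2.
  set A := \sum_(s in T) _; set B := \sum_(s in T) _ => B0 AB h.
  have -> : 2 * alpha * sqnorm T g = alpha * (B + A) by rewrite -AB; ring.
  have : 0 <= (alpha - 1) * A by rewrite mulr_ge0 ?subr_ge0.
  lra.
have := H g g0.
have : (nu - mu) * (pair_sq W (bd eps T g)
    + \sum_(s in T) (2 - pair_sq W (eps s)) * g s ^+ 2) <=
    (nu - mu) * (2 * alpha * sqnorm T g).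
  by rewrite ler_wpM2l ?subr_ge0.
rewrite /schur_form; set S := \sum_(s in T) _; set D := \sum_(a in W) _.
nra.
Qed.

(** * Vertex counts and the bound for two orthogonal vectors *)

Lemma deg_gt0 s v : s \in K -> v \in s -> (0 < deg K v)%N.
Proof. by move=> sK vs; apply/card_gt0P; exists s; rewrite inE sK. Qed.

(** Each leaf triangle owns a vertex of degree 1, so sending such a vertex to its triangle covers
    [T]. *)
Lemma card_leaf_triangles : (#|T| + #|W| <= conj_deg K 1)%N.
Proof.
have -> : #|W| = #|[set v | (0 < deg K v)%N] :&: W|.
  by apply: eq_card => v; rewrite !inE; case: (deg K v) => [|[]].
rewrite /conj_deg -(cardsID W [set v | (0 < deg K v)%N]) addnC leq_add2l.
pose f v := odflt set0 [pick s in K | v \in s].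
apply: leq_trans (leq_imset_card f _); apply: subset_leq_card.
apply/subsetP => s; rewrite inE => /andP[sK /subsetPn[v vs vW]].
apply/imsetP; exists v; first by rewrite in_setD vW inE (deg_gt0 sK).
rewrite /f; case: pickP => [t /= /andP[tK vt]|/(_ s)]; last by rewrite sK vs.
exact: leaf_vertex_triangle vW sK tK vs vt.
Qed.

(** This is [pair_sq_bd_le] on the set of covered vertices, off which the boundary vanishes. *)
Lemma pair_sq_bd_le_support u :
  pair_sq setT (bd eps K u) <= 2 * (conj_deg K 1)%:R * sqnorm K u.
Proof.
set D := [set v | (1 <= deg K v)%N].
apply: le_trans (pair_sq_bd_le u Ho K3 (subxx K) (W := D) _); last first.
  by move=> s sK; apply/subsetP => v vs; rewrite inE (deg_gt0 sK).
have z a b : (a \notin D) || (b \notin D) -> bd eps K u a b = 0.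
  move=> ab; apply: big1 => s sK; rewrite (orientation_eq0 Ho) ?mulr0 //.
  by apply: contraL ab => /and3P[_ sa sb]; rewrite !inE !(deg_gt0 sK).
rewrite /pair_sq (sum_supported (subsetT D)) => [|a aD].
  apply: ler_sum => a _; rewrite (sum_supported (subsetT D)) // => b bD.
  by rewrite z ?bD ?orbT // expr0n.
by apply: big1 => b _; rewrite z ?aD // expr0n.
Qed.

(** No edge lies inside the core, so no two triangles share an edge and the form is diagonal. *)
Lemma pair_sq_bd_small_core u : (#|W| <= 1)%N ->
  pair_sq setT (bd eps K u) = 6 * sqnorm K u.
Proof.
move=> W1; have TK : T = K.
  apply/setP => s; rewrite inE; case sK: (s \in K) => //=.
  by apply/negP => /subset_leq_card; rewrite K3 // leqNgt ltnS (leq_trans W1).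
have ab a b : a \in W -> b \in W -> a = b by move=> aW bW; exact: (card_le1_eqP W1).
have W0 (x : V -> V -> R) : skew x -> pair_sq W x = 0.
  move=> xs; apply: big1 => a aW; apply: big1 => b bW.
  by rewrite (ab _ _ aW bW) skew_diag ?expr0n.
rewrite pair_sq_bd_split W0 ?add0r; last exact: skew_bd Ho (subxx K).
rewrite TK mulr_sumr; apply: eq_bigr => s sK.
by have [es _ _] := Ho sK; rewrite W0 // subr0.
Qed.

(** The union of [s] and [t] consists of vertices of positive degree, their intersection of core
    vertices. *)
Lemma two_triangles_card s t : s \in K -> t \in K -> s != t ->
  (6 <= conj_deg K 1 + #|W|)%N.
Proof.
move=> sK tK st; have <- : (#|s| + #|t| = 6)%N by rewrite !K3.
rewrite -cardsUI; apply: leq_add; apply: subset_leq_card; apply/subsetP => v.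
  by rewrite !inE => /orP[]; apply: deg_gt0.
rewrite !inE => /andP[vs vt].
have <- : #|[set s; t]| = 2%N by rewrite cards2 st.
by apply/subset_leq_card/subsetP => r; rewrite !inE => /orP[]/eqP ->; apply/andP.
Qed.

(** The last two hypotheses encode that [u1] and [u2] are orthogonal both for the norm and for the
    boundary form, with squared norms [p1], [p2] and Rayleigh quotients [l1], [l2]; the factor 2 is
    the double count of edges. *)
Lemma sum_two_eigenvalues_le (u1 u2 : {set V} -> R) (l1 l2 p1 p2 : R) :
  0 < p1 -> 0 < p2 -> 0 < l2 -> l2 <= l1 ->
  (forall a b, sqnorm K (fun s => a * u1 s + b * u2 s) =
     a ^+ 2 * p1 + b ^+ 2 * p2) ->
  (forall a b, pair_sq setT (bd eps K (fun s => a * u1 s + b * u2 s)) =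
     2 * (a ^+ 2 * (l1 * p1) + b ^+ 2 * (l2 * p2))) ->
  l1 + l2 <= (conj_deg K 1 + #|W|)%:R.
Proof.
move=> p10 p20 l20 l21 nrm bnd; rewrite natrD.
set m : R := #|W|%:R; set n : R := (conj_deg K 1)%:R.
pose mix a b s : R := a * u1 s + b * u2 s.
have l1n : l1 <= n.
  have := pair_sq_bd_le_support (mix 1 0); rewrite bnd nrm -/n.
  rewrite !expr1n expr0n /= !mul0r !addr0 !mul1r.
  by rewrite -mulrA ler_pM2l ?ltr0n // ler_pM2r.
have [l2m|ml2] := lerP l2 m; first exact: lerD.
have ray a b : 2 * l2 * sqnorm K (mix a b) <= pair_sq setT (bd eps K (mix a b)).
  rewrite bnd nrm -mulrA ler_pM2l ?ltr0n // mulrDr lerD //; last by rewrite mulrCA.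
  by rewrite mulrCA ler_wpM2l ?sqr_ge0 // ler_pM2r.
(* In the degenerate case both quotients are 3, and two orthogonal vectors require two triangles. *)
have [m2|m1] := leqP 2 #|W|; last first.
  have {}bnd a b := etrans (esym (bnd a b)) (pair_sq_bd_small_core (mix a b) m1).
  have l13 : l1 = 3.
    have := bnd 1 0; rewrite nrm; nra.
  have l23 : l2 = 3.
    have := bnd 0 1; rewrite nrm; nra.
  have [s sK [t tK st]] : exists2 s, s \in K & exists2 t, t \in K & s != t.
    have [s sK] : exists s, s \in K.
      apply/set0Pn; apply: contraTneq p10 => K0.
      have := nrm 1 0; rewrite /sqnorm K0 big_set0; nra.
    exists s => //; apply/exists_inP; apply: contraT => /exists_inPn Ks.
    have sqE h : sqnorm K h = h s ^+ 2.
      rewrite /sqnorm (bigD1 s sK) /= big1 ?addr0 // => t /andP[/Ks].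
      by rewrite negbK eq_sym => ->.
    (* With a single triangle, this combination would vanish. *)
    have := nrm (u2 s) (- u1 s); have := nrm 1 0; rewrite !sqE.
    have := sqr_ge0 (u2 s); nra.
  rewrite l13 l23; apply: (@le_trans _ _ 6%:R); first by lra.
  by rewrite /n /m -natrD ler_nat (two_triangles_card sK tK st).
have m2R : 2 <= m by rewrite ler_nat.
have l22 : 2 < l2 by exact: le_lt_trans ml2.
rewrite leNgt; apply/negP => absurd.
have Tn : #|T|%:R + m <= n by rewrite -natrD ler_nat card_leaf_triangles.
have u1_mix s : mix 1 0 s = u1 s by rewrite /mix mul1r mul0r addr0.
have mixT a b : 0 < a ^+ 2 * p1 + b ^+ 2 * p2 -> 0 < sqnorm T (mix a b).
  by rewrite -nrm; apply: leaf_part_neq0 ml2 _; exact: ray.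
have main y : 0 < sqnorm T y ->
    schur_form l2 y < 2 * (l2 - 2) * (l1 - m) * sqnorm T y.
  move=> y0; rewrite ltNge; apply/negP => hy.
  pose i1 := \sum_(s in T) u1 s * y s; pose i2 := \sum_(s in T) u2 s * y s.
  (* The plane of [u1] and [u2] contains a vector orthogonal to [y] on the leaf triangles. Together
     with [y] it would push the trace, [2 * (l2 - 2) * #|T|], above its bound. *)
  have [a [b [ab0 orth]]] : exists a b, 0 < a ^+ 2 * p1 + b ^+ 2 * p2 /\
      a * i1 + b * i2 = 0.
    have [z1|n1] := eqVneq i1 0.
      by exists 1, 0; rewrite z1 expr1n expr0n /= !mul0r mulr0 !addr0 mul1r.
    exists i2, (- i1); split; last by ring.
    have : 0 < i1 ^+ 2 by rewrite lt_neqAle eq_sym sqrf_eq0 n1 sqr_ge0.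
    have := sqr_ge0 i2; nra.
  have w0 := mixT _ _ ab0.
  have yw : \sum_(s in T) y s * mix a b s = 0.
    rewrite -[RHS]orth /i1 /i2 !mulr_sumr -big_split.
    by apply: eq_bigr => s _; rewrite /mix /=; ring.
  have := schur_form_trace (ltW l22) (ltW ml2) y0 w0 yw.
  rewrite (eq_bigr (fun=> 2 * (l2 - 2))) => [|s sT]; last exact: schur_form_delta.
  rewrite sumr_const -mulr_natr.
  have := schur_form_ge m2R ml2 (ray a b); rewrite -/m => hw.
  have {}hy : 2 * (l2 - 2) * (l1 - m) <= schur_form l2 y / sqnorm T y.
    by rewrite ler_pdivlMr.
  have {}hw : 2 * (l2 - m) * (l2 - 2) <=
      schur_form l2 (mix a b) / sqnorm T (mix a b).
    by rewrite ler_pdivlMr.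
  have : (l2 - 2) * #|T|%:R <= (l2 - 2) * (n - m).
    by rewrite ler_pM2l ?subr_gt0 //; lra.
  have : 0 < (l2 - 2) * (l1 + l2 - (n + m)) by rewrite mulr_gt0 // subr_gt0.
  lra.
(* The strict bound carries over from [l2] to [l1], where [schur_form_ge] at [u1] contradicts it. *)
have g0 : 0 < sqnorm T (mix 1 0) by apply: mixT; nra.
have := schur_form_le_mono l22 l21 main g0.
rewrite ltNge => /negP; apply.
apply: le_trans (schur_form_ge m2R (lt_le_trans ml2 l21) _); last first.
  by rewrite bnd nrm; nra.
rewrite -/m [leLHS](_ : _ = 2 * (l1 - m) * (l1 - 2) * sqnorm T (mix 1 0)) //.
by ring.
Qed.

End LeafTriangles.

(** * From the matrix of the boundary map to skew chains *)

Section UpLaplacian.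

Variables (R : realType) (d : Order.disp_t) (V : finOrderType d).
Variable K : {set {set V}}.
Hypothesis K3 : is_3family K.
Implicit Types (s e : {set V}) (v w : 'rV[R]_#|edges K|).

Definition order_sign (a b : V) : R :=
  if (a < b)%O then 1 else if (b < a)%O then -1 else 0.

(** [boundary_coef] sees unordered edges only; the sign of the vertex order makes it skew. *)
Definition skew_boundary s (a b : V) : R :=
  boundary_coef R s [set a; b] * order_sign a b.

Lemma order_signN a b : order_sign a b = - order_sign b a.
Proof. by rewrite /order_sign; case: ltgtP; rewrite ?opprK ?oppr0. Qed.

Lemma order_sign_sqr a b : order_sign a b ^+ 2 = (a != b)%:R.
Proof. by rewrite /order_sign; case: ltgtP; rewrite ?sqrrN ?expr1n ?expr0n. Qed.

Lemma eq_set2_lt (a b i j : V) : (a < b)%O -> (i < j)%O ->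
  ([set a; b] == [set i; j]) = (a == i) && (b == j).
Proof.
move=> ab ij; apply/eqP/andP => [/setP E|[/eqP-> /eqP->]] //.
have := E a; have := E b; rewrite !inE !eqxx !orbT /= => /esym bE /esym aE.
case/orP: aE ab => /eqP->; case/orP: bE => /eqP->; rewrite ?ltxx ?eqxx //.
by move=> ji; have := lt_trans ij ji; rewrite ltxx.
Qed.

Lemma card3_sorted s : #|s| = 3%N ->
  exists i j k, [/\ (i < j)%O, (j < k)%O & s = [set i; j; k]].
Proof.
move=> s3; have : size (sort <=%O (enum s)) = 3%N by rewrite size_sort -cardE.
have : sorted <%O (sort <=%O (enum s)) by rewrite sort_lt_sorted enum_uniq.
have : sort <=%O (enum s) =i s by move=> a; rewrite mem_sort mem_enum.
case: (sort _ _) => [|i [|j [|k []]]] //= sE /and3P[ij jk _] _.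
by exists i, j, k; split => //; apply/setP => a; rewrite -sE !inE orbA.
Qed.

Lemma skew_boundaryE i j k (a b : V) : (i < j)%O -> (j < k)%O ->
  skew_boundary [set i; j; k] a b =
  edge_form R i j a b - edge_form R i k a b + edge_form R j k a b.
Proof.
move=> ij jk; have ik := lt_trans ij jk.
rewrite /skew_boundary boundary_coefE // /order_sign /edge_form.
(* An increasing pair cannot match another one in reverse, so one product of each [edge_form]
   vanishes. *)
have lt0 (p q p' q' : V) : (p < q)%O -> (p' < q')%O ->
    (p == q')%:R * (q == p')%:R = 0 :> R.
  move=> pq pq'; case: eqP => [E|_]; last by rewrite mul0r.
  case: eqP => [E'|_]; last by rewrite mulr0.
  by move: pq; rewrite E E' ltNge ltW.
case: ltgtP => [ab|ba|->].
- rewrite !eq_set2_lt // (lt0 a b i j) // (lt0 a b i k) // (lt0 a b j k) //.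
  rewrite !subr0 mulr1.
  by rewrite -!mulnb !natrM; ring.
- rewrite setUC !eq_set2_lt // ![(a == _)%:R * _]mulrC.
  rewrite (lt0 b a i j) // (lt0 b a i k) // (lt0 b a j k) //.
  by rewrite -!mulnb !natrM; ring.
- by rewrite mulr0; ring.
Qed.

Lemma skew_boundary_orientation : orientation K skew_boundary.
Proof.
move=> s sK; have [i [j [k [ij jk sE]]]] := card3_sorted (K3 sK).
have ik := lt_trans ij jk.
have [nij nik njk] : [/\ i != j, i != k & j != k] by rewrite !lt_eqF.
have sym : skew (skew_boundary s).
  by move=> a b; rewrite /skew_boundary order_signN setUC mulrN.
have sqr a b : skew_boundary s a b ^+ 2 = [&& a != b, a \in s & b \in s]%:R.
  rewrite sE skew_boundaryE // /edge_form !inE.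
  have cs c : [\/ c = i, c = j, c = k | [&& c != i, c != j & c != k]].
    have [->|ci] := eqVneq c i; first by constructor 1.
    have [->|cj] := eqVneq c j; first by constructor 2.
    by have [->|ck] := eqVneq c k; [constructor 3 | constructor 4].
  case: (cs a) => [->|->|->|/and3P[/negPf ai /negPf aj /negPf ak]];
    case: (cs b) => [->|->|->|/and3P[/negPf bi /negPf bj /negPf bk]];
    rewrite ?eqxx ?[j == i]eq_sym ?[k == i]eq_sym ?[k == j]eq_sym
      ?(negPf nij) ?(negPf nik) ?(negPf njk) ?ai ?aj ?ak ?bi ?bj ?bk
      /= ?andbF ?andbT /=; try ring.
split => // a; have [sa|sa] := boolP (a \in s); last first.
  apply: big1 => b _; apply/eqP.
  by rewrite -sqrf_eq0 sqr (negPf sa) andbF.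
move: sa; rewrite sE big_set3 // !inE -orbA => /or3P[]/eqP ->;
  rewrite !skew_boundaryE // /edge_form;
  rewrite ?eqxx ?[j == i]eq_sym ?[k == i]eq_sym ?[k == j]eq_sym
    ?(negPf nij) ?(negPf nik) ?(negPf njk) /=; ring.
Qed.

Lemma boundary_coef_eq0 s e : s \in K -> boundary_coef R s e != 0 ->
  e \in edges K.
Proof.
move=> sK; have [i [j [k [ij jk sE]]]] := card3_sorted (K3 sK).
have ik := lt_trans ij jk.
have sub p q : p \in s -> q \in s -> (p < q)%O -> [set p; q] \in edges K.
  move=> sp sq pq; rewrite inE cards2 (lt_eqF pq) /=; apply/exists_inP.
  by exists s => //; rewrite subUset !sub1set sp sq.
have [si sj sk] : [/\ i \in s, j \in s & k \in s].
  by rewrite sE !inE !eqxx !orbT.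
rewrite {1}sE boundary_coefE // => n0.
have [->|e1] := eqVneq e [set j; k]; first exact: sub.
have [->|e2] := eqVneq e [set i; k]; first exact: sub.
have [->|e3] := eqVneq e [set i; j]; first exact: sub.
by move: n0; rewrite (negPf e1) (negPf e2) (negPf e3) subr0 addr0 eqxx.
Qed.

Lemma big_set2_pairs (H : {set V} -> R) :
  \sum_(a : V) \sum_(b : V) (a != b)%:R * H [set a; b] =
  2 * \sum_(e : {set V} | #|e| == 2%N) H e.
Proof.
transitivity (\sum_(e : {set V} | #|e| == 2%N) \sum_(a in e) \sum_(b in e)
    (a != b)%:R * H e).
  transitivity (\sum_(a : V) \sum_(b : V) \sum_(e : {set V} | #|e| == 2%N)
      ((a != b) && (e == [set a; b]))%:R * H e).
    apply: eq_bigr => a _; apply: eq_bigr => b _.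
    have [->|ab] := eqVneq a b.
      by rewrite mul0r big1 // => e _; rewrite mul0r.
    rewrite (bigD1 [set a; b]) /= ?cards2 ?ab // eqxx big1 ?addr0 //.
    by move=> e /andP[_ /negPf ->]; rewrite mul0r.
  under eq_bigr => a _ do rewrite exchange_big /=.
  rewrite exchange_big; apply: eq_bigr => e /eqP e2 /=.
  have mem (a b : V) : (a != b) && (e == [set a; b]) =
      [&& a \in e, b \in e & a != b].
    apply/andP/and3P => [[ab /eqP ->]|[ae be ab]].
      by rewrite !inE !eqxx orbT.
    split => //; rewrite eq_sym eqEcard cards2 ab e2 subUset !sub1set ae be.
    by [].
  rewrite [RHS]big_mkcond; apply: eq_bigr => a _.
  rewrite [in RHS]big_mkcond; case: ifP => ae; last first.
    by apply: big1 => b _; rewrite mem ae mul0r.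
  by apply: eq_bigr => b _; rewrite mem ae /=; case: (b \in e); rewrite ?mul0r.
rewrite mulr_sumr; apply: eq_bigr => e /cards2P[x [y [xy ->]]].
have S2 (h : V -> R) : \sum_(a in [set x; y]) h a = h x + h y.
  by rewrite big_setU1 ?inE // big_set1.
by rewrite !S2 !eqxx [y == x]eq_sym xy /=; ring.
Qed.

(** The 2-chain [bd^T v], which carries eigenvectors of [bd bd^T] to the triangle form. *)
Definition chain v s : R := \sum_i v 0 i * boundary_coef R s (enum_val i).

Lemma chain_mulmx v j : (v *m boundary2 R K) 0 j = chain v (enum_val j).
Proof. by rewrite mxE; apply: eq_bigr => i _; rewrite mxE. Qed.

Lemma chain_linear (a b : R) v w s :
  chain (a *: v + b *: w) s = a * chain v s + b * chain w s.
Proof.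
rewrite /chain !mulr_sumr -big_split; apply: eq_bigr => i _ /=.
by rewrite !mxE; ring.
Qed.

Lemma chain_sqnorm v :
  sqnorm K (chain v) = (v *m up_laplacian R K *m v^T) 0 0.
Proof.
rewrite /up_laplacian mulmxA -[_ *m v^T]mulmxA -trmx_mul rowvec_normE.
by rewrite /sqnorm big_enum_val; apply: eq_bigr => j _; rewrite chain_mulmx.
Qed.

(** The boundary of [chain v] is [v L], with [L] the up-Laplacian. Pairs outside [edges K]
    contribute nothing, and each edge occurs in both orders. *)
Lemma chain_bd v : pair_sq setT (bd skew_boundary K (chain v)) =
  2 * ((v *m up_laplacian R K) *m (v *m up_laplacian R K)^T) 0 0.
Proof.
pose h e := \sum_(s in K) chain v s * boundary_coef R s e.
have -> : pair_sq setT (bd skew_boundary K (chain v)) =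
    \sum_a \sum_b (a != b)%:R * h [set a; b] ^+ 2.
  rewrite /pair_sq (eq_bigl predT) => [|a]; last by rewrite inE.
  apply: eq_bigr => a _; rewrite (eq_bigl predT) => [|b]; last by rewrite inE.
  apply: eq_bigr => b _; rewrite -order_sign_sqr -exprMn; congr (_ ^+ 2).
  rewrite /bd /h mulr_sumr; apply: eq_bigr => s _.
  by rewrite /skew_boundary; ring.
rewrite (big_set2_pairs (fun e => h e ^+ 2)) rowvec_normE; congr (2 * _).
transitivity (\sum_(e in edges K) h e ^+ 2).
  rewrite [RHS]big_mkcond [LHS]big_mkcond; apply: eq_bigr => e _ /=.
  case: (boolP (e \in edges K)) => [|eK]; first by rewrite inE => /andP[-> _].
  case: ifP => // _; rewrite /h big1 ?expr0n // => s sK.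
  apply/eqP; rewrite mulf_eq0; apply/orP; right.
  by apply: contraNT eK; exact: boundary_coef_eq0.
rewrite big_enum_val; apply: eq_bigr => i _; congr (_ ^+ 2).
rewrite /up_laplacian mulmxA mxE /h big_enum_val; apply: eq_bigr => j _.
by rewrite chain_mulmx !mxE.
Qed.

Lemma up_laplacian_sym : (up_laplacian R K)^T = up_laplacian R K.
Proof. by rewrite /up_laplacian trmx_mul trmxK. Qed.

Lemma rowvec_norm_gt0 n (v : 'rV[R]_n) : v != 0 -> 0 < (v *m v^T) 0 0.
Proof.
move=> v0; rewrite lt_neqAle eq_sym rowvec_norm_eq0 v0 rowvec_normE.
by apply: sumr_ge0 => i _; exact: sqr_ge0.
Qed.

Lemma rowvec_dot_orthogonal n (v w : 'rV[R]_n) (a b a' b' : R) :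
  v *m w^T = 0 ->
  ((a *: v + b *: w) *m (a' *: v + b' *: w)^T) 0 0 =
  a * a' * (v *m v^T) 0 0 + b * b' * (w *m w^T) 0 0.
Proof.
move=> vw; have wv : w *m v^T = 0 by rewrite -[w]trmxK -trmx_mul vw trmx0.
rewrite linearD /= !linearZ /= mulmxDl !mulmxDr -!scalemxAl -!scalemxAr.
rewrite vw wv !scaler0 addr0 add0r !scalerA.
by rewrite [LHS]mxE [X in X + _]mxE [X in _ + X]mxE.
Qed.

Lemma eigval1_up_laplacian_le :
  eigval (up_laplacian R K) 1 <= (conj_deg K 1)%:R.
Proof.
have [->|l0] := eqVneq (eigval (up_laplacian R K) 1) 0; first exact: ler0n.
have [v vA v0] := eigval1_eigenvector l0.
set l := eigval _ _ in l0 vA *.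
have [lneg|lpos] := lerP l 0; first by rewrite (le_trans lneg).
have q0 := rowvec_norm_gt0 v0.
have := pair_sq_bd_le_support skew_boundary_orientation K3 (chain v).
rewrite chain_bd chain_sqnorm vA.
have -> : (l *: v *m v^T) 0 0 = l * (v *m v^T) 0 0 by rewrite -scalemxAl mxE.
have -> : (l *: v *m (l *: v)^T) 0 0 = l * (l * (v *m v^T) 0 0).
  by rewrite linearZ /= -scalemxAl -scalemxAr !mxE.
by rewrite -mulrA ler_pM2l ?ltr0n // ler_pM2r // mulr_gt0.
Qed.

End UpLaplacian.

Theorem corollary2 (R : realType) (d : Order.disp_t) (V : finOrderType d)
    (K : {set {set V}}) (hK : is_3family K) :
  eigval (up_laplacian R K) 1 + eigval (up_laplacian R K) 2
    <= (conj_deg K 1 + conj_deg K 2)%N%:R.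
Proof.
(* This covers the default value 0; the bound on the first eigenvalue suffices. *)
have [l2neg|l2pos] := lerP (eigval (up_laplacian R K) 2) 0.
  rewrite natrD lerD ?eigval1_up_laplacian_le //.
  exact: le_trans l2neg (ler0n _ _).
have l2n0 : eigval (up_laplacian R K) 2 != 0 by rewrite gt_eqF.
have [l21 [v [w [v0 w0 vA wA vw]]]] :=
  eigval12_eigenvectors (up_laplacian_sym R K) l2n0.
set l1 := eigval _ 1 in l21 vA *; set l2 := eigval _ 2 in l2pos l2n0 l21 wA *.
have mixA a b : (a *: v + b *: w) *m up_laplacian R K =
    (a * l1) *: v + (b * l2) *: w.
  by rewrite mulmxDl -!scalemxAl vA wA !scalerA.
(* The squared norm of [chain v] is [v L v^T], which is [l1] times that of [v]. *)
apply: (sum_two_eigenvalues_le (skew_boundary_orientation R hK) hK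
  (u1 := chain v) (u2 := chain w) (p1 := l1 * (v *m v^T) 0 0)
  (p2 := l2 * (w *m w^T) 0 0)) => //.
- by rewrite mulr_gt0 ?rowvec_norm_gt0 // (lt_le_trans l2pos).
- by rewrite mulr_gt0 ?rowvec_norm_gt0.
- move=> a b.
  transitivity (sqnorm K (chain (a *: v + b *: w))).
    by apply: eq_bigr => s _; rewrite chain_linear.
  by rewrite chain_sqnorm mixA rowvec_dot_orthogonal //; ring.
- move=> a b.
  transitivity
    (pair_sq setT (bd (@skew_boundary R _ V) K (chain (a *: v + b *: w)))).
    do 2!apply: eq_bigr => ? _; congr (_ ^+ 2).
    by apply: eq_bigr => s _; rewrite chain_linear.
  by rewrite (chain_bd hK) mixA rowvec_dot_orthogonal //; ring.
Qed.
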